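(* Let $d\ge 1$. Let $G=(V,E)$ be a $d$-regular bipartite graph with $2n$ vertices and $\nu(G)=d-\sqrt d$, and let $\sigma:E^{or}(G)\to S^1$ be a maximal magnetic potential. Enumerate the vertices of $G$ such that the first $n$ vertices form $V_1$ and the last $n$ vertices form $V_2$, where $V=V_1\cup V_2$ is a bipartite vertex partition. Then the magnetic adjacency matrix $A^\sigma$ has the block structure $$A^\sigma=\begin{pmatrix}\mathbf{0}_n & B\\ \overline{B}^\top & \mathbf{0}_n\end{pmatrix}$$ with an $n\times n$ matrix $B$ satisfying $$\left(\frac{1}{\sqrt d}B\right)\left(\frac{1}{\sqrt d}\overline{B}^\top\right)=\mathrm{Id}_n,$$ and all non-zero entries of $B$ have modulus $1$. Conversely, any complex $n\times n$ matrix $B$ with $n\ge d$ having these properties (that is, $B\overline{B}^\top=d\cdot\mathrm{Id}_n$ and all non-zero entries of $B$ have modulus $1$) provides a $d$-regular bipartite graph $G=(V,E)$ with $2n$ vertices and adjacency matrix $$A_G=\begin{pmatrix}\mathbf{0}_n & |B|\\ |B|^\top & \mathbf{0}_n\end{pmatrix},$$ where $|B|$ is the matrix with entries $|B|_{jk}=|B_{jk}|$ for $j,k\in\{1,\dots,n\}$.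
   Context: All graphs $G=(V,E)$ are finite and simple; $x\sim y$ denotes adjacency. $E^{or}(G)$ is the set of ordered pairs $(x,y)$ with $x\sim y$. A magnetic potential is a map $\sigma:E^{or}(G)\to S^1=\{z\in\mathbb{C}:|z|=1\}$ with $\sigma(y,x)=\sigma(x,y)^{-1}$. The magnetic Laplacian on functions $f:V\to\mathbb{C}$ is $\Delta^\sigma f(x)=\sum_{y\sim x}(f(x)-\sigma(x,y)f(y))$, and $\lambda_1^\sigma(G)$ is its smallest eigenvalue. The magneto-spectral height is $\nu(G)=\sup_\sigma\lambda_1^\sigma(G)$, over all magnetic potentials; $\sigma$ is maximal if $\lambda_1^\sigma(G)=\nu(G)$. For a $d$-regular graph, the magnetic adjacency matrix is $A^\sigma=d\cdot\mathrm{Id}-\Delta^\sigma$ with respect to the chosen enumeration of the vertices. $\mathbf{0}_n$ is the $n\times n$ zero matrix and $\overline{B}^\top$ the conjugate transpose. *)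

(* Defs.v *)
From HB Require Import structures.
From mathcomp Require Import all_boot all_order all_algebra.
From mathcomp Require Import complex.
From mathcomp Require Import boolp classical_sets reals.

Set Implicit Arguments.
Unset Strict Implicit.
Unset Printing Implicit Defensive.

Import Order.TTheory GRing.Theory Num.Theory.
Local Open Scope ring_scope.
Local Open Scope complex_scope.

Record sgraph (V : finType) := SGraph {
  adj :> rel V;
  adj_sym : symmetric adj;
  adj_irr : irreflexive adj }.

Section Graph.
Variables (V : finType) (G : sgraph V).

Definition regular (d : nat) : Prop := forall x : V, #|[pred y | G x y]| = d.

Definition bipartition (V1 V2 : {set V}) : Prop :=
  [/\ [disjoint V1 & V2], V1 :|: V2 = [set: V]%SET,
      {in V1 &, forall x y, ~~ G x y} & {in V2 &, forall x y, ~~ G x y}].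

Definition bipartite : Prop := exists V1 V2 : {set V}, bipartition V1 V2.

(* [e (lshift n i)] and [e (rshift n i)] are the first n and last n vertices. *)
Definition enumerates (n : nat) (V1 V2 : {set V}) (e : 'I_(n + n) -> V) : Prop :=
  [/\ bijective e,
      V1 = [set e (lshift n i) | i : 'I_n] &
      V2 = [set e (rshift n i) | i : 'I_n]].

Definition adj_mx (C : nzRingType) (m : nat) (e : 'I_m -> V) : 'M[C]_m :=
  \matrix_(i, j) (G (e i) (e j))%:R.

Variable R : realType.
Implicit Types s : V -> V -> R[i].

(* A potential is a total function constrained on oriented edges only; its
   values on nonadjacent pairs are never used. *)
Definition magnetic_potential s : Prop :=
  forall x y, G x y -> `|s x y| = 1 /\ s y x = (s x y)^-1.

Definition mag_lap s (f : {ffun V -> R[i]^o}) : {ffun V -> R[i]^o} :=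
  [ffun x => \sum_(y | G x y) (f x - s x y * f y)].

Fact mag_lap_linear s : linear (mag_lap s).
Proof.
move=> a f g; apply/ffunP => x; rewrite !ffunE scaler_sumr -big_split /=.
apply: eq_bigr => y _; rewrite !ffunE /GRing.scale /=.
by rewrite mulrBr mulrDr opprD addrACA mulrCA.
Qed.

HB.instance Definition _ s :=
  GRing.isLinear.Build R[i] {ffun V -> R[i]^o} {ffun V -> R[i]^o} _
    (mag_lap s) (mag_lap_linear s).

(* For a potential s on a nonempty graph the operator is Hermitian, so its
   eigenvalues are all real and finite in number, and the infimum is a minimum. *)
Definition lambda1 s : R :=
  inf [set l : R | passmx.leigenvalue (linfun (mag_lap s)) l%:C]%classic.

Definition nu : R :=
  sup [set lambda1 s | s in [set s | magnetic_potential s]]%classic.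

Definition maximal_potential s : Prop :=
  magnetic_potential s /\ lambda1 s = nu.

(* Column j holds the image of the indicator function of the j-th vertex. *)
Definition mag_lap_mx s (m : nat) (e : 'I_m -> V) : 'M[R[i]]_m :=
  \matrix_(i, j) mag_lap s [ffun x => (x == e j)%:R] (e i).

Definition mag_adj_mx (d : nat) s (m : nat) (e : 'I_m -> V) : 'M[R[i]]_m :=
  d%:R%:M - mag_lap_mx s e.

End Graph.

Arguments nu {V} G R.

Definition unimodular_entries (R : realType) (n : nat) (B : 'M[R[i]]_n) : Prop :=
  forall j k, B j k != 0 -> `|B j k| = 1.

(* Main.v *)
Require Import Defs.
From HB Require Import structures.
From mathcomp Require Import all_boot all_order all_algebra.
From mathcomp Require Import complex.
From mathcomp Require Import boolp classical_sets reals.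
Import Order.TTheory GRing.Theory Num.Theory.
Local Open Scope ring_scope.
Local Open Scope complex_scope.
Local Open Scope sesquilinear_scope.

Set Implicit Arguments.
Unset Strict Implicit.
Unset Printing Implicit Defensive.

(** The vertices of a bipartite graph split the magnetic adjacency matrix into
    two off-diagonal blocks B and its adjoint, and the nonzero entries of B are
    the values of the potential, hence unimodular.  For a d-regular graph the
    content of the first half is that B B^* = d I.

    Let u be an eigenvector of B B^* with eigenvalue mu > 0.  Stacking
    sqrt(mu) u on B^* u gives an eigenvector of the magnetic adjacency matrix
    with eigenvalue sqrt(mu), so d - sqrt(mu) is an eigenvalue of the Laplacian
    and is at least its smallest eigenvalue d - sqrt(d): all eigenvalues of
    B B^* are at most d ([gram_block_eigenvalue_le]).  On the other hand every
    row of B has exactly d unimodular entries, so the diagonal of B B^* is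
    constantly d, and the average of its eigenvalues is d.  Numbers that are at
    most their own average are all equal to it, and a Hermitian matrix with the
    single eigenvalue d is d I ([gram_scalar]).  That the two sides have equal
    size, so that the enumeration exists, is a double count of the edges
    ([card_sides]).

    For the converse, the graph is the one whose edges are the nonzero entries
    of B, with the rows on one side and the columns on the other.  When the
    nonzero entries are unimodular, the diagonal of B B^* counts the nonzero
    entries of the rows; and B B^* = d I with d > 0 forces B^* B = d I, since B
    is square, so that columns have d nonzero entries too
    ([support_regular]). *)

(** * Gram matrices with constant diagonal *)

Lemma gram_diagE (C : numClosedFieldType) m n (B : 'M[C]_(m, n)) i :
  (B *m B ^t*) i i = \sum_j `|B i j| ^+ 2.
Proof. by rewrite mxE; apply: eq_bigr => j _; rewrite !mxE normCK. Qed.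

Lemma trmxC_mul (C : numClosedFieldType) m n p (A : 'M[C]_(m, n))
    (B : 'M[C]_(n, p)) : (A *m B) ^t* = B ^t* *m A ^t*.
Proof. by rewrite trmx_mul map_mxM. Qed.

(** The eigenvalues of the Gram matrix, all nonnegative, are bounded by c and
    their sum, the trace, is n c; so each of them is c, and a diagonalizable
    matrix with a single eigenvalue is scalar. *)
Lemma gram_scalar (C : numClosedFieldType) n (B : 'M[C]_n) (c : C) :
  (forall i, (B *m B ^t*) i i = c) ->
  (forall (u : 'cV[C]_n) mu, u != 0 -> 0 <= mu ->
     B *m B ^t* *m u = mu *: u -> mu <= c) ->
  B *m B ^t* = c%:M.
Proof.
move=> diagM eig_le; set M := B *m B ^t*.
have hermM : M ^t* = M by rewrite trmxC_mul trmxCK.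
have /orthomx_spectralP : M \is normalmx by apply/normalmxP; rewrite hermM.
set P := spectralmx M; set sp := spectral_diag M => defM.
have Pu : P \is unitarymx := spectral_unitarymx M.
have Punit := unitarymx_unit Pu.
have MP : M *m invmx P = invmx P *m diag_mx sp.
  by rewrite defM -!mulmxA mulmxV // mulmx1.
have PMP : diag_mx sp = (P *m B) *m (P *m B) ^t*.
  rewrite trmxC_mul -(invmx_unitary Pu).
  by rewrite mulmxA -(mulmxA P) -mulmxA MP mulKVmx.
(* The spectrum is the diagonal of the Gram matrix of P B, hence it is
   nonnegative. *)
have sp_ge0 i : 0 <= sp 0 i.
  have := congr1 (fun N : 'M_n => N i i) PMP.
  rewrite gram_diagE mxE eqxx mulr1n => ->.
  by apply: sumr_ge0 => j _; rewrite exprn_ge0.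
have sp_le i : sp 0 i <= c.
  apply: (eig_le (invmx P *m delta_mx i 0)) => //.
    apply/eqP => /(congr1 (mulmx P)); rewrite mulKVmx // mulmx0.
    by move/matrixP/(_ i 0)/eqP; rewrite !mxE !eqxx oner_eq0.
  rewrite -/M mulmxA MP -mulmxA scalemxAr; congr (_ *m _).
  apply/colP => k; rewrite mul_diag_mx !mxE.
  by have [->|] := eqVneq k i; rewrite ?mulr0.
have sum0 : \sum_i (c - sp 0 i) = 0.
  rewrite sumrB; apply/eqP; rewrite subr_eq0; apply/eqP.
  transitivity (\tr M); first by apply: eq_bigr => i _; rewrite diagM.
  by rewrite defM mxtrace_mulC mulmxA mulmxV // mul1mx mxtrace_diag.
have spc : diag_mx sp = c%:M.
  apply/matrixP => i j; rewrite !mxE; congr (_ *+ _).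
  have /psumr_eq0P/(_ sum0 i isT)/eqP : forall k, true -> 0 <= c - sp 0 k.
    by move=> k _; rewrite subr_ge0.
  by rewrite subr_eq0 => /eqP.
by rewrite defM spc mul_mx_scalar -scalemxAl mulVmx // scalemx1.
Qed.

(** * The magnetic Laplacian and its smallest eigenvalue *)

Section Graph.
Variables (V : finType) (G : sgraph V) (R : realType).
Implicit Types s : V -> V -> R[i].

Lemma leigenvalue_mag_lap s (l : R[i]) :
  passmx.leigenvalue (linfun (mag_lap G s)) l <->
  exists2 f : {ffun V -> R[i]^o}, f != 0 & mag_lap G s f = l *: f.
Proof.
rewrite /passmx.leigenvalue /passmx.leigenspace; set ph := (X in lker X).
have phE f : ph f = mag_lap G s f - l *: f.
  by rewrite /ph add_lfunE opp_lfunE scale_lfunE id_lfunE lfunE.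
split=> [ker0|[f f0 fl]].
  exists (vpick (lker ph)); first by rewrite vpick0.
  by apply/eqP; rewrite -subr_eq0 -phE -memv_ker memv_pick.
apply/eqP => ker0; have : f \in lker ph by rewrite memv_ker phE fl subrr.
by rewrite ker0 memv0 (negPf f0).
Qed.

(** Gershgorin's argument: read the eigenvalue equation at a vertex where the
    eigenfunction has maximal modulus.  A real infimum is a lower bound of its
    set only when the set is bounded below, so some bound of this kind is what
    makes [lambda1] comparable with the eigenvalues. *)
Lemma eigenvalue_lbound s d : magnetic_potential G s -> regular G d ->
  lbound [set l : R | passmx.leigenvalue (linfun (mag_lap G s)) l%:C]%classic
    (- (d + d)%:R).
Proof.
move=> pot reg l /leigenvalue_mag_lap [f f0 fl].
have [x0 fx0] : exists x, f x != 0.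
  apply/existsP; apply: contraNT f0; rewrite negb_exists => /forallP f0.
  by apply/eqP/ffunP => x; rewrite ffunE; apply/eqP; rewrite -[_ == _]negbK.
case: (@arg_maxP _ R V x0 xpredT (fun x => complex.Re `|f x|)) => // x _ xmax.
have fmax y : `|f y| <= `|f x|.
  rewrite -[`|f y|](RRe_real (normr_real _)) -[`|f x|](RRe_real (normr_real _)).
  by rewrite lecR; apply: xmax.
have fx_gt0 : 0 < `|f x| by apply: lt_le_trans (fmax x0); rewrite normr_gt0.
have /ffunP/(_ x) := fl; rewrite !ffunE => fxl.
have : `|l%:C| * `|f x| <= (d + d)%:R * `|f x|.
  rewrite -normrM -[l%:C * f x]fxl.
  apply: le_trans (ler_norm_sum _ _ _) _.
  apply: (@le_trans _ _ (\sum_(y | G x y) (`|f x| *+ 2))).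
    apply: ler_sum => y xy; apply: le_trans (ler_normB _ _) _.
    by rewrite normrM (pot _ _ xy).1 mul1r mulr2n lerD.
  by rewrite sumr_const reg -mulrnA mulr_natl mul2n addnn.
rewrite ler_pM2r // => /(le_trans (normc_ge_Re _)).
rewrite -(rmorph_nat (real_complex R)) lecR /= => l_le.
exact: lerNnormlW.
Qed.

Lemma lambda1_le s d (f : {ffun V -> R[i]^o}) (l : R) :
  magnetic_potential G s -> regular G d ->
  f != 0 -> mag_lap G s f = l%:C *: f -> lambda1 G s <= l.
Proof.
move=> pot reg f0 fl; apply: ge_inf.
  by exists (- (d + d)%:R); apply: eigenvalue_lbound.
by apply/leigenvalue_mag_lap; exists f.
Qed.

Lemma mag_adj_mxE s d m (e : 'I_m -> V) i j :
  regular G d -> injective e ->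
  mag_adj_mx G d s e i j = (G (e i) (e j))%:R * s (e i) (e j).
Proof.
move=> reg inj_e; rewrite !mxE ffunE.
under eq_bigr do rewrite !ffunE.
rewrite sumrB sumr_const reg (inj_eq inj_e) -mulr_natl.
have -> : \sum_(y | G (e i) y) s (e i) y * (y == e j)%:R
    = (G (e i) (e j))%:R * s (e i) (e j).
  case: (boolP (G (e i) (e j))) => Gij.
    rewrite (bigD1 (e j)) //= eqxx mulr1 big1 ?addr0 ?mul1r //.
    by move=> y /andP[_ /negPf->]; rewrite mulr0.
  rewrite mul0r big1 // => y Gy; case: eqP Gy Gij => [->->|]//.
  by rewrite mulr0.
by rewrite mulr1 -!mulrnA mulnC opprB addrC addrNK.
Qed.

Lemma mag_lapE s d m (e : 'I_m -> V) (f : {ffun V -> R[i]^o}) i :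
  regular G d -> bijective e ->
  mag_lap G s f (e i)
    = d%:R * f (e i) - \sum_j mag_adj_mx G d s e i j * f (e j).
Proof.
move=> reg bij_e; rewrite ffunE sumrB sumr_const reg mulr_natl.
congr (_ - _); rewrite [LHS](reindex e) /=; last exact: onW_bij.
rewrite big_mkcond; apply: eq_bigr => j _.
rewrite mag_adj_mxE //; last exact: bij_inj.
by case: (G _ _); rewrite ?mul1r ?mul0r.
Qed.

End Graph.

(** * The two sides of a regular bipartite graph *)

Section Bipartite.
Variables (V : finType) (G : sgraph V).

Lemma bipartitionC V1 V2 : bipartition G V1 V2 -> bipartition G V2 V1.
Proof.
by case=> dis cov in1 in2; split; rewrite // 1?disjoint_sym // finset.setUC.
Qed.

Lemma degree_across d V1 V2 x : regular G d -> bipartition G V1 V2 ->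
  x \in V1 -> (\sum_(y in V2) G x y)%N = d.
Proof.
move=> reg [_ cov in1 _] xV1; rewrite -(reg x) -sum1_card big_mkcond.
rewrite [RHS]big_mkcond; apply: eq_bigr => y _; rewrite inE.
case: ifP => yV2; first by case: (G x y).
case: ifP => // Gxy; have : y \in [set: V]%SET by [].
by rewrite -cov inE yV2 orbF => /(in1 x y xV1); rewrite Gxy.
Qed.

(** Both sides, multiplied by d, count the edges. *)
Lemma card_sides d V1 V2 : (0 < d)%N -> regular G d -> bipartition G V1 V2 ->
  #|V1| = #|V2|.
Proof.
move=> d_gt0 reg bip; apply/eqP; rewrite -(eqn_pmul2r d_gt0) -!sum_nat_const.
apply/eqP; transitivity (\sum_(x in V1) \sum_(y in V2) G x y)%N.
  by apply: eq_bigr => x xV1; rewrite (degree_across reg bip).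
rewrite exchange_big; apply: eq_bigr => y yV2 /=.
rewrite -[RHS](degree_across reg (bipartitionC bip) yV2).
by apply: eq_bigr => x _; rewrite adj_sym.
Qed.

Lemma enumerates_exists n V1 V2 : bipartition G V1 V2 ->
  #|V1| = n -> #|V2| = n -> exists e : 'I_(n + n) -> V, enumerates V1 V2 e.
Proof.
move=> [dis cov _ _] c1 c2.
pose e (i : 'I_(n + n)) := match split i with
  | inl j => enum_val (cast_ord (esym c1) j)
  | inr j => enum_val (cast_ord (esym c2) j) end.
have el j : e (lshift n j) = enum_val (cast_ord (esym c1) j).
  by rewrite /e -[lshift n j]/(unsplit (inl j)) unsplitK.
have er j : e (rshift n j) = enum_val (cast_ord (esym c2) j).
  by rewrite /e -[rshift n j]/(unsplit (inr j)) unsplitK.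
have sub1 j : e (lshift n j) \in V1 by rewrite el enum_valP.
have sub2 j : e (rshift n j) \in V2 by rewrite er enum_valP.
have sur1 x : x \in V1 -> exists j, x = e (lshift n j).
  move=> xV; exists (cast_ord c1 (enum_rank_in xV x)).
  by rewrite el cast_ordK enum_rankK_in.
have sur2 x : x \in V2 -> exists j, x = e (rshift n j).
  move=> xV; exists (cast_ord c2 (enum_rank_in xV x)).
  by rewrite er cast_ordK enum_rankK_in.
exists e; split.
- apply: inj_card_bij.
    move=> i j; rewrite -(splitK i) -(splitK j).
    case: (split i) => {}i; case: (split j) => {}j /=.
    + by rewrite !el => /enum_val_inj /cast_ord_inj ->.
    + by move=> eij; have := disjointFr dis (sub1 i); rewrite eij sub2.
    + by move=> eij; have := disjointFr dis (sub1 j); rewrite -eij sub2.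
    + by rewrite !er => /enum_val_inj /cast_ord_inj ->.
  rewrite card_ord -finset.cardsT -cov finset.cardsU c1 c2; exact: leq_subr.
- apply/finset.setP => x; apply/idP/imsetP => [/sur1[j ->]|[j _ ->]//].
  by exists j.
- apply/finset.setP => x; apply/idP/imsetP => [/sur2[j ->]|[j _ ->]//].
  by exists j.
Qed.

End Bipartite.

(** * The off-diagonal block of the magnetic adjacency matrix *)

(** Singular vectors of B give eigenvectors of the Hermitian matrix with
    off-diagonal blocks B and B^*. *)
Lemma block_eigenvector (C : numClosedFieldType) n (B : 'M[C]_n) (u : 'cV[C]_n)
    r :
  B *m B ^t* *m u = r ^+ 2 *: u ->
  block_mx 0 B (B ^t*) 0 *m col_mx (r *: u) (B ^t* *m u)
    = r *: col_mx (r *: u) (B ^t* *m u).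
Proof.
move=> eig; rewrite mul_block_col !mul0mx add0r addr0 mulmxA eig.
by rewrite -scalemxAr scale_col_mx scalerA expr2.
Qed.

Section Forward.
Variables (R : realType) (V : finType) (G : sgraph V) (d n : nat).
Variables (s : V -> V -> R[i]) (V1 V2 : {set V}) (e : 'I_(n + n) -> V).
Hypotheses (pot : magnetic_potential G s) (reg : regular G d).
Hypotheses (bip : bipartition G V1 V2) (enum_e : enumerates V1 V2 e).

Let B : 'M[R[i]]_n := ursubmx (mag_adj_mx G d s e).

Let bij_e : bijective e. Proof. by case: enum_e. Qed.

Let e_lshift i : e (lshift n i) \in V1.
Proof. by case: enum_e => _ -> _; apply: finset.imset_f. Qed.

Let e_rshift i : e (rshift n i) \in V2.
Proof. by case: enum_e => _ _ ->; apply: finset.imset_f. Qed.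

Let adjE i j := mag_adj_mxE s i j reg (bij_inj bij_e).

Let blockE j k : B j k = (G (e (lshift n j)) (e (rshift n k)))%:R
  * s (e (lshift n j)) (e (rshift n k)).
Proof. by rewrite 2!mxE adjE. Qed.

Lemma mag_adj_block : mag_adj_mx G d s e = block_mx 0 B (B ^t*) 0.
Proof.
have [_ _ in1 in2] := bip.
rewrite -[LHS]submxK; congr block_mx; apply/matrixP => i j.
- by rewrite 2!mxE adjE (negPf (in1 _ _ _ _)) // mul0r mxE.
- rewrite 2!mxE adjE [RHS]mxE [in RHS]mxE blockE adj_sym rmorphM rmorph_nat.
  have [Gij|_] := boolP (G _ _); last by rewrite !mul0r.
  have [s1 sV] := pot Gij.
  by rewrite !mul1r sV invC_norm s1 expr1n invr1 mul1r.
- by rewrite 2!mxE adjE (negPf (in2 _ _ _ _)) // mul0r mxE.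
Qed.

Lemma norm_block j k :
  `|B j k| = (G (e (lshift n j)) (e (rshift n k)))%:R.
Proof.
rewrite blockE.
have [Gjk|_] := boolP (G _ _); last by rewrite mul0r normr0.
by rewrite mul1r (pot Gjk).1.
Qed.

Lemma unimodular_block : unimodular_entries B.
Proof.
move=> j k; rewrite -normr_eq0 norm_block.
by case: (G _ _); rewrite ?eqxx.
Qed.

Lemma diag_gram_block i : (B *m B ^t*) i i = d%:R.
Proof.
rewrite gram_diagE -(degree_across reg bip (e_lshift i)) natr_sum.
have [_ _ ->] := enum_e.
rewrite big_imset /=; last by move=> j k _ _ /(bij_inj bij_e)/rshift_inj.
rewrite [RHS]big_mkcond; apply: eq_bigr => j _; rewrite norm_block.
by case: (G _ _); rewrite ?expr1n ?expr0n ?finset.in_setT.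
Qed.

Hypothesis lambda1_s : lambda1 G s = d%:R - Num.sqrt d%:R.

(** An eigenvalue mu > 0 yields the Laplacian eigenvalue d - sqrt(mu), which the
    smallest eigenvalue d - sqrt(d) bounds from below. *)
Lemma gram_block_eigenvalue_le (u : 'cV[R[i]]_n) mu : u != 0 -> 0 <= mu ->
  B *m B ^t* *m u = mu *: u -> mu <= d%:R.
Proof.
move=> u0 mu_ge0 eig.
(* The stacked vector may vanish when mu = 0, but then there is nothing to
   prove. *)
have [->|mu0] := eqVneq mu 0; first exact: ler0n.
have muE : mu = (complex.Re mu)%:C by rewrite RRe_real // ger0_real.
have m_ge0 : 0 <= complex.Re mu by rewrite -ler0c -muE.
pose r := Num.sqrt (complex.Re mu).
have r2 : r%:C ^+ 2 = mu by rewrite -rmorphXn /= sqr_sqrtr // -muE.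
have r0 : r%:C != 0 by apply: contraNneq mu0 => r0; rewrite -r2 r0 expr0n.
rewrite -r2 in eig; have := block_eigenvector eig.
set w := col_mx _ _ => Aw.
have [e' eK e'K] := bij_e.
pose f : {ffun V -> R[i]^o} := [ffun x => w (e' x) 0].
have fe i : f (e i) = w i 0 by rewrite ffunE eK.
have f0 : f != 0.
  apply: contraNneq u0 => f0; apply/eqP/colP => i.
  have := fe (lshift n i); rewrite f0 col_mxEu !mxE ffunE => /esym/eqP.
  by rewrite mulf_eq0 (negPf r0) => /eqP.
have lap : mag_lap G s f = (d%:R - r)%:C *: f.
  apply/ffunP => x; rewrite -(e'K x) (mag_lapE s _ _ reg bij_e) mag_adj_block.
  rewrite [RHS]ffunE !fe /GRing.scale /= rmorphB rmorph_nat mulrBl.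
  congr (_ - _).
  move/colP/(_ (e' x)): Aw; rewrite !mxE => <-.
  by apply: eq_bigr => j _; rewrite fe.
have := lambda1_le pot reg f0 lap; rewrite lambda1_s lerD2l lerN2.
rewrite ler_sqrt ?ler0n // => le_d.
by rewrite muE -(rmorph_nat (real_complex R)) lecR.
Qed.

Lemma gram_block : B *m B ^t* = d%:R%:M.
Proof. exact: (gram_scalar diag_gram_block gram_block_eigenvalue_le). Qed.

End Forward.

(** * The bipartite graph supporting a matrix *)

Section SupportGraph.
Variables (R : realType) (n : nat) (B : 'M[R[i]]_n).

Definition support_rel (x y : 'I_n + 'I_n) : bool :=
  match x, y with
  | inl j, inr k | inr k, inl j => B j k != 0
  | _, _ => false
  end.

Lemma support_rel_sym : symmetric support_rel.
Proof. by do 2!case=> ?. Qed.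

Lemma support_rel_irr : irreflexive support_rel.
Proof. by case. Qed.

Definition support_graph := SGraph support_rel_sym support_rel_irr.

Lemma support_bipartite : bipartite support_graph.
Proof.
exists [set inl j | j : 'I_n], [set inr k | k : 'I_n]; split.
- rewrite -setI_eq0; apply/eqP/finset.setP => x; rewrite !inE.
  by apply/negP => /andP[/imsetP[j _ ->] /imsetP[]].
- apply/finset.setP => -[j|k]; rewrite !inE; apply/orP.
    by left; apply: finset.imset_f.
  by right; apply: finset.imset_f.
- by move=> x y /imsetP[j _ ->] /imsetP[k _ ->].
- by move=> x y /imsetP[j _ ->] /imsetP[k _ ->].
Qed.

Hypothesis unimod : unimodular_entries B.

Lemma unimodular_norm j k : `|B j k| = (B j k != 0)%:R.
Proof.
by have [->|/unimod ->] := eqVneq (B j k) 0; rewrite ?normr0.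
Qed.

Lemma support_adj_mx :
  adj_mx support_graph R[i] (@split n n) =
    block_mx 0 (map_mx Num.norm B) (map_mx Num.norm B)^T 0.
Proof.
have sl (j : 'I_n) : @split n n (lshift n j) = inl j.
  by rewrite (unsplitK (inl j)).
have sr (j : 'I_n) : @split n n (rshift n j) = inr j.
  by rewrite (unsplitK (inr j)).
rewrite -[LHS]submxK; congr block_mx; apply/matrixP => j k;
  by rewrite !mxE ?sl ?sr // unimodular_norm.
Qed.

End SupportGraph.

Lemma card_row_support (R : realType) n (B : 'M[R[i]]_n) d j :
  unimodular_entries B -> (B *m B ^t*) j j = d%:R ->
  #|[pred k | B j k != 0]| = d.
Proof.
move=> unimod diagB; apply/eqP; rewrite -(eqr_nat R[i]) -diagB gram_diagE.
rewrite -sum1_card natr_sum big_mkcond; apply/eqP/eq_bigr => k _.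
by rewrite unimodular_norm // inE; case: eqP; rewrite ?expr1n ?expr0n.
Qed.

(** Row vertices have degree d by the diagonal of B B^*.  For column vertices
    one uses B^* B = d I, which follows because the right inverse d^-1 B^* of
    the square matrix B is also its left inverse. *)
Lemma support_regular (R : realType) n (B : 'M[R[i]]_n) d : (0 < d)%N ->
  unimodular_entries B -> B *m B ^t* = d%:R%:M -> regular (support_graph B) d.
Proof.
move=> d_gt0 unimod BB.
have d0 : d%:R != 0 :> R[i] by rewrite pnatr_eq0 -lt0n.
have B'B : B ^t* *m B = d%:R%:M.
  have : (d%:R^-1 *: B) *m B ^t* = 1%:M.
    by rewrite -scalemxAl BB scale_scalar_mx mulVf.
  move/mulmx1C; rewrite -scalemxAr => /(congr1 ( *:%R d%:R)).
  by rewrite scalerA divff // scale1r scalemx1.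
case=> j.
  rewrite -(card_row_support (j := j) unimod (d := d)); last first.
    by rewrite BB mxE eqxx.
  rewrite -(card_imset _ (@inr_inj 'I_n 'I_n)) -[LHS]cardsE; apply: eq_card.
  case=> k; rewrite !inE; apply/idP/imsetP => //.
  - by case.
  - by exists k.
  - by case=> k' + [->].
have unimod' : unimodular_entries (B ^t*).
  move=> i k; rewrite mxE [in X in `|X|]mxE mxE conjC_eq0 norm_conjC.
  exact: unimod.
rewrite -(card_row_support (j := j) unimod' (d := d)); last first.
  by rewrite trmxCK B'B mxE eqxx.
rewrite -(card_imset _ (@inl_inj 'I_n 'I_n)) -[LHS]cardsE; apply: eq_card.
case=> k; rewrite !inE; apply/idP/imsetP => //.
- by exists k; rewrite // inE mxE mxE conjC_eq0.
- by case=> k' + [->]; rewrite inE mxE mxE conjC_eq0.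
- by case.
Qed.

(** * The characterization *)

Unset Implicit Arguments.

Theorem theorem3p15 (R : realType) (d : nat) (d_ge1 : (1 <= d)%N) :
  (forall (V : finType) (G : sgraph V) (n : nat) (s : V -> V -> R[i]),
      regular G d -> bipartite G -> #|V| = (2 * n)%N ->
      nu G R = d%:R - Num.sqrt d%:R ->
      maximal_potential G s ->
      forall V1 V2 : {set V}, bipartition G V1 V2 ->
        (exists e : 'I_(n + n) -> V, enumerates V1 V2 e) /\
        (forall e : 'I_(n + n) -> V, enumerates V1 V2 e ->
           exists B : 'M[R[i]]_n,
             [/\ mag_adj_mx G d s e = block_mx 0 B (B ^t*) 0,
                 ((sqrtC d%:R)^-1 *: B) *m ((sqrtC d%:R)^-1 *: B ^t*) = 1%:M &
                 unimodular_entries B]))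
  /\
  (forall (n : nat) (B : 'M[R[i]]_n),
      (d <= n)%N -> B *m B ^t* = d%:R%:M -> unimodular_entries B ->
      exists (V : finType) (G : sgraph V) (e : 'I_(n + n) -> V),
        [/\ #|V| = (2 * n)%N, regular G d, bipartite G, bijective e &
            adj_mx G R[i] e =
              block_mx 0 (map_mx Num.norm B) (map_mx Num.norm B)^T 0]).
Proof.
split=> [V G n s reg _ cardV nuG [pot lam] V1 V2 bip|n B _ BB unimod].
  split.
    have cV1 : #|V1| = n.
      have [dis cov _ _] := bip.
      apply: double_inj; rewrite -[n.*2]mul2n -cardV -finset.cardsT -cov.
      rewrite finset.cardsU (disjoint_setI0 dis) finset.cards0 subn0.
      by rewrite -(card_sides d_ge1 reg bip) addnn.
    by apply: (enumerates_exists bip cV1); rewrite -(card_sides d_ge1 reg bip).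
  move=> e enum_e; exists (ursubmx (mag_adj_mx G d s e)); split.
  - exact: (mag_adj_block pot reg bip enum_e).
  - have d0 : d%:R != 0 :> R[i] by rewrite pnatr_eq0 -lt0n.
    rewrite -scalemxAl -scalemxAr scalerA -invfM -expr2 sqrtCK.
    rewrite (gram_block pot reg bip enum_e (etrans lam nuG)).
    by rewrite scale_scalar_mx mulVf.
  - exact: (unimodular_block pot reg enum_e).
exists ('I_n + 'I_n)%type, (support_graph B), (@split n n); split.
- by rewrite card_sum card_ord mul2n addnn.
- exact: support_regular.
- exact: support_bipartite.
- by exists unsplit; [exact: splitK | exact: unsplitK].
- exact: support_adj_mx.
Qed.
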